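(* Let $F_1,F_2$ be two distinct points in the Euclidean plane and let $O$ be the midpoint of the segment $F_1F_2$. Let $A,B$ be points lying strictly on opposite sides of the line $F_1F_2$ with $|F_1A|=|F_2B|=\frac{1}{\sqrt2}|F_1F_2|$ and $|AB|=|F_1F_2|$, and suppose that the lines $F_1A$ and $F_2B$ are not parallel. Let $P$ be the point of intersection of the lines $F_1A$ and $F_2B$, and let $X$ be the midpoint of $AB$ (a point of the lemniscate of Bernoulli with foci $F_1$ and $F_2$). Then the points $X$ and $O$ lie on a common circle centered at $P$, and this circle touches the lemniscate of Bernoulli with foci $F_1$ and $F_2$ at the point $X$.
   Context: The lemniscate of Bernoulli with foci $F_1\neq F_2$ is the set of points $X$ of the plane such that $|F_1X|\cdot|F_2X|=\frac14|F_1F_2|^2$. A circle touches the lemniscate at a point $X\neq O$ if both pass through $X$ and have the same tangent line there. *)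

(* Defs.v *)
From Stdlib Require Import Reals.
From Coquelicot Require Import Coquelicot.
Open Scope R_scope.

Definition point : Type := (R * R)%type.

(* Coquelicot's norm on a product is the Euclidean one, not the sup norm
   (see [pdistE]). *)
Definition pdist (A B : point) : R := norm (minus B A).

Definition midpoint (A B : point) : point := scal (/ 2) (plus A B).

(* A line when [A <> B]. *)
Definition line (A B : point) : point -> Prop :=
  fun Y => exists t : R, Y = plus A (scal t (minus B A)).

Definition segment (A B : point) : point -> Prop :=
  fun Y => exists t : R, 0 <= t <= 1 /\ Y = plus A (scal t (minus B A)).

Definition strictly_opposite_sides (l : point -> Prop) (A B : point) : Prop :=
  ~ l A /\ ~ l B /\ exists M : point, segment A B M /\ l M.

(* Coincident lines count as parallel. *)
Definition parallel (l m : point -> Prop) : Prop :=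
  (forall Y, l Y <-> m Y) \/ ~ (exists Y, l Y /\ m Y).

Definition circle (P : point) (r : R) : point -> Prop :=
  fun Y => pdist P Y = r.

Definition lemniscate (F1 F2 : point) : point -> Prop :=
  fun Y => pdist F1 Y * pdist F2 Y = / 4 * pdist F1 F2 ^ 2.

(* Signed area of the parallelogram spanned by [AB] and [AC]. *)
Definition cross (A B C : point) : R :=
  fst (minus B A) * snd (minus C A) - snd (minus B A) * fst (minus C A).

(* The sine of the angle between the lines [AB] and [AC]. *)
Definition sin_lines (A B C : point) : R :=
  Rabs (cross A B C) / (pdist A B * pdist A C).

(* The line [XQ] is the tangent line at [X] of the curve [S], as the limit of
   the secants [XY] when [Y] tends to [X] along [S].  The requirement that [X]
   is not isolated in [S] makes this line unique; at the double point of a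
   lemniscate no line satisfies the definition. *)
Definition is_tangent_line (S : point -> Prop) (X Q : point) : Prop :=
  Q <> X /\ S X /\
  (forall eps : posreal, exists Y, ball X eps Y /\ S Y /\ Y <> X) /\
  filterlim (fun Y => sin_lines X Q Y)
    (within (fun Y => S Y /\ Y <> X) (locally X)) (locally 0).

Definition circle_touches_lemniscate
    (P : point) (r : R) (F1 F2 X : point) : Prop :=
  X <> midpoint F1 F2 /\ circle P r X /\ lemniscate F1 F2 X /\
  exists Q : point,
    is_tangent_line (circle P r) X Q /\ is_tangent_line (lemniscate F1 F2) X Q.

Lemma pdistE (A B : point) :
  pdist A B = sqrt ((fst B - fst A) ^ 2 + (snd B - snd A) ^ 2).
Proof.
  destruct A as [a1 a2], B as [b1 b2].
  unfold pdist, norm, minus, plus, opp; simpl.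
  unfold prod_norm, norm, abs, plus, opp; simpl; unfold abs; simpl.
  f_equal; rewrite !Rmult_1_r.
  rewrite <- !Rabs_mult, !Rabs_pos_eq by apply Rle_0_sqr.
  reflexivity.
Qed.

(* Main.v *)
Require Import Defs.
From Stdlib Require Import Reals Lra.
From Coquelicot Require Import Coquelicot.
Open Scope R_scope.

(** In the antiparallelogram [F1 A B F2] the axis of symmetry of the figure
    exchanges [F1] with [B] and [A] with [F2].  It passes through [P], the
    intersection of the exchanged lines [F1 A] and [F2 B], and it exchanges the
    midpoints [O] and [X] of the sides [F1 F2] and [A B]; hence [PO = PX].
    Moreover [P] is the instantaneous centre of rotation of the bar [A B] of
    the linkage, so [X] moves perpendicularly to [PX], which is also the tangent
    direction of the circle.

    The proof carries this out by algebra with origin [P].  Put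
    [u = A - F1], [v = B - F2], [P = F1 + s u = F2 + t v].  Since [u] and [v]
    are not parallel, the equations [|AB|^2 = |F1F2|^2 = 2 |u|^2] give
    [s + t = 1] and [2 s t (|u|^2 + u.v) = - |u|^2] ([crossing_parameters]).  Then
    [F1 = - s u], [F2 = - t v], [A = t u], [B = s v] and
    [X = (t u + s v) / 2], and the squared focal radii of [X] are
    [- s / t] and [- t / s] times [|u|^2 / 2]
    ([antiparallelogram_focal_radii]).  Their product gives the lemniscate
    equation, and they also show that the gradient at [X] of the product of
    the two squared distances is a nonzero multiple of [X - P], like the
    gradient of the squared distance to [P].

    Both curves are therefore level curves with parallel nonzero gradients at
    [X], and a level curve of a differentiable function has, in the sense of
    limits of secants, the tangent line orthogonal to its gradient
    ([level_curve_tangent]). *)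

(** * Points and distances in coordinates *)

Definition sqdist (A B : point) : R :=
  (fst B - fst A) ^ 2 + (snd B - snd A) ^ 2.

Lemma sqdist_ge0 (A B : point) : 0 <= sqdist A B.
Proof. apply Rplus_le_le_0_compat; apply pow2_ge_0. Qed.

Lemma pdist_sqrt (A B : point) : pdist A B = sqrt (sqdist A B).
Proof. exact (pdistE A B). Qed.

Lemma pdist_sqr (A B : point) : pdist A B ^ 2 = sqdist A B.
Proof. rewrite pdist_sqrt; apply pow2_sqrt, sqdist_ge0. Qed.

Lemma pdist_ge0 (A B : point) : 0 <= pdist A B.
Proof. rewrite pdist_sqrt; apply sqrt_pos. Qed.

Lemma point_eq (A B : point) : fst A = fst B -> snd A = snd B -> A = B.
Proof. destruct A, B; simpl; congruence. Qed.

Lemma sqdist_gt0 (A B : point) : A <> B -> 0 < sqdist A B.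
Proof.
  intros hAB.
  destruct (Rle_lt_or_eq_dec _ _ (sqdist_ge0 A B)) as [h | h]; [exact h |].
  exfalso; apply hAB; unfold sqdist in h.
  destruct (Rplus_sqr_eq_0 (fst B - fst A) (snd B - snd A)) as [h1 h2].
  { rewrite !Rsqr_pow2; lra. }
  apply point_eq; lra.
Qed.

Lemma eq_of_sqr_eq (x y : R) : 0 <= x -> 0 <= y -> x ^ 2 = y ^ 2 -> x = y.
Proof. intros hx hy h; nra. Qed.

Lemma lineE (A B Y : point) :
  line A B Y <->
  exists t, fst Y = fst A + t * (fst B - fst A) /\
            snd Y = snd A + t * (snd B - snd A).
Proof.
  split.
  - intros [t ->]; exists t; split; reflexivity.
  - intros [t [h1 h2]]; exists t; apply point_eq; [exact h1 | exact h2].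
Qed.

Lemma crossE (A B C : point) :
  cross A B C = (fst B - fst A) * (snd C - snd A)
              - (snd B - snd A) * (fst C - fst A).
Proof. reflexivity. Qed.

Lemma midpoint_fst (A B : point) : fst (midpoint A B) = (fst A + fst B) / 2.
Proof. unfold midpoint, scal, plus; simpl; unfold scal, plus; simpl.
  unfold mult; simpl; field. Qed.

Lemma midpoint_snd (A B : point) : snd (midpoint A B) = (snd A + snd B) / 2.
Proof. unfold midpoint, scal, plus; simpl; unfold scal, plus; simpl.
  unfold mult; simpl; field. Qed.

(** * Tangent lines of level curves *)

(** If [h = Y - X] stays on the level curve, differentiability makes the scalar
    product of the gradient with [h] a [o(|h|)].  Since the line [XQ] is
    orthogonal to the gradient [g], the sine of the angle from [XQ] to [XY] is
    [|g.h| / (|g| |h|)], and it tends to [0]. *)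
Lemma level_curve_secants (G Ga Gb : R -> R -> R) (X Q : point) :
  (forall x y, differentiable_pt_lim G x y (Ga x y) (Gb x y)) ->
  let a := Ga (fst X) (snd X) in
  let b := Gb (fst X) (snd X) in
  0 < a ^ 2 + b ^ 2 ->
  Q <> X ->
  a * (fst Q - fst X) + b * (snd Q - snd X) = 0 ->
  filterlim (fun Y => sin_lines X Q Y)
    (within (fun Y => G (fst Y) (snd Y) = G (fst X) (snd X) /\ Y <> X)
       (locally X)) (locally 0).
Proof.
  intros dG a b hab hQ horth.
  apply filterlim_locally; intros eps.
  set (g := sqrt (a ^ 2 + b ^ 2)).
  assert (hg : 0 < g) by (apply sqrt_lt_R0; exact hab).
  assert (hg2 : g ^ 2 = a ^ 2 + b ^ 2) by (apply pow2_sqrt; lra).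
  assert (he : 0 < eps * g / 2).
  { apply Rdiv_lt_0_compat; [|lra].
    apply Rmult_lt_0_compat; [apply cond_pos | exact hg]. }
  destruct (dG (fst X) (snd X) (mkposreal _ he)) as [d hd].
  exists d; intros Y [hY1 hY2] [hG hYX]; change point in Y; simpl in hd.
  assert (hXY : 0 < pdist X Y).
  { rewrite pdist_sqrt; apply sqrt_lt_R0, sqdist_gt0; congruence. }
  assert (hXQ : 0 < pdist X Q).
  { rewrite pdist_sqrt; apply sqrt_lt_R0, sqdist_gt0; congruence. }
  specialize (hd (fst Y) (snd Y) hY1 hY2).
  rewrite hG in hd.
  fold a b in hd.
  set (h1 := fst Y - fst X) in *; set (h2 := snd Y - snd X) in *.
  assert (hmax : Rmax (Rabs h1) (Rabs h2) <= pdist X Y).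
  { rewrite pdist_sqrt; unfold sqdist; fold h1 h2.
    apply Rmax_lub; rewrite <- sqrt_Rsqr_abs; apply sqrt_le_1_alt;
      unfold Rsqr; nra. }
  assert (hlin : Rabs (a * h1 + b * h2) <= eps * g / 2 * pdist X Y).
  { rewrite <- Rabs_Ropp.
    replace (- (a * h1 + b * h2)) with
      (G (fst X) (snd X) - G (fst X) (snd X) - (a * h1 + b * h2)) by ring.
    eapply Rle_trans; [exact hd |].
    apply Rmult_le_compat_l; [lra | exact hmax]. }
  assert (hcross : g * Rabs (cross X Q Y) = Rabs (a * h1 + b * h2) * pdist X Q).
  { apply eq_of_sqr_eq.
    - apply Rmult_le_pos; [lra | apply Rabs_pos].
    - apply Rmult_le_pos; [apply Rabs_pos | lra].
    - rewrite !Rpow_mult_distr, !pow2_abs, pdist_sqr, hg2.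
      unfold sqdist; rewrite crossE; fold h1 h2.
      set (q1 := fst Q - fst X) in *; set (q2 := snd Q - snd X) in *.
      (* The two sides differ by a multiple of [a * q1 + b * q2]. *)
      apply Rminus_diag_uniq.
      match goal with |- ?L = 0 => replace L with
        ((a * q1 + b * q2) *
         (h2 ^ 2 * (a * q1 - b * q2) + h1 ^ 2 * (b * q2 - a * q1)
          - 2 * h1 * h2 * (a * q2 + b * q1))) by ring end.
      rewrite horth; ring. }
  change (Rabs (sin_lines X Q Y - 0) < eps).
  unfold sin_lines; rewrite Rminus_0_r.
  assert (hden : 0 < pdist X Q * pdist X Y) by (apply Rmult_lt_0_compat; lra).
  rewrite Rabs_pos_eq.
  2:{ apply Rle_div_r; [lra |]; rewrite Rmult_0_l; apply Rabs_pos. }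
  apply Rlt_div_l; [lra |].
  apply Rmult_lt_reg_l with g; [exact hg |].
  rewrite hcross.
  apply Rle_lt_trans with (eps * g / 2 * pdist X Y * pdist X Q).
  { apply Rmult_le_compat_r; [lra | exact hlin]. }
  assert (0 < eps * g / 2 * pdist X Y * pdist X Q).
  { apply Rmult_lt_0_compat; [apply Rmult_lt_0_compat |]; assumption. }
  lra.
Qed.

(** Points of the level curve near [X] come from the intermediate value theorem:
    move by [dl] along the tangent direction [(-b, a)], then by [s] along the gradient [(a, b)] with [s] between [- dl] and [dl].  The
    increment of [G] is [s (a^2 + b^2)] up to half of [dl (a^2 + b^2)], so it
    changes sign and vanishes for some [s]. *)
Lemma level_curve_not_isolated (G Ga Gb : R -> R -> R) (X : point) :
  (forall x y, differentiable_pt_lim G x y (Ga x y) (Gb x y)) ->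
  0 < Ga (fst X) (snd X) ^ 2 + Gb (fst X) (snd X) ^ 2 ->
  forall eps : posreal, exists Y : point,
    ball X eps Y /\ G (fst Y) (snd Y) = G (fst X) (snd X) /\ Y <> X.
Proof.
  intros dG.
  set (a := Ga (fst X) (snd X)); set (b := Gb (fst X) (snd X)).
  intros hab eps.
  set (M := Rabs a + Rabs b).
  assert (hM : 0 < M).
  { apply Rnot_le_lt; unfold M; intros hM.
    pose proof (Rabs_pos a); pose proof (Rabs_pos b).
    rewrite <- (pow2_abs a), <- (pow2_abs b) in hab.
    replace (Rabs a) with 0 in hab by lra.
    replace (Rabs b) with 0 in hab by lra; lra. }
  assert (he : 0 < (a ^ 2 + b ^ 2) / (2 * M)) by (apply Rdiv_lt_0_compat; lra).
  destruct (dG (fst X) (snd X) (mkposreal _ he)) as [d hd]; simpl in hd.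
  fold a b in hd.
  (* [M] bounds the sup norm of [Y - X] divided by [dl]. *)
  set (dl := Rmin d eps / (2 * M)).
  assert (hmin : 0 < Rmin d eps) by (apply Rmin_pos; apply cond_pos).
  assert (hdl : 0 < dl) by (apply Rdiv_lt_0_compat; lra).
  assert (hdlM : dl * M = Rmin d eps / 2) by (unfold dl; field; lra).
  pose proof (Rmin_l d eps); pose proof (Rmin_r d eps).
  pose (y1 := fun s : R => fst X - dl * b + s * a).
  pose (y2 := fun s : R => snd X + dl * a + s * b).
  assert (hsmall : forall s, - dl <= s <= dl ->
    Rabs (y1 s - fst X) <= dl * M /\ Rabs (y2 s - snd X) <= dl * M).
  { intros s hs; unfold y1, y2, M.
    assert (habs : Rabs s <= dl) by (apply Rabs_le; lra).
    split.
    - replace (fst X - dl * b + s * a - fst X) with (s * a + - (dl * b)) by ring.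
      eapply Rle_trans; [apply Rabs_triang |].
      rewrite Rabs_Ropp, !Rabs_mult, (Rabs_pos_eq dl) by lra.
      pose proof (Rmult_le_compat_r _ _ _ (Rabs_pos a) habs); lra.
    - replace (snd X + dl * a + s * b - snd X) with (s * b + dl * a) by ring.
      eapply Rle_trans; [apply Rabs_triang |].
      rewrite !Rabs_mult, (Rabs_pos_eq dl) by lra.
      pose proof (Rmult_le_compat_r _ _ _ (Rabs_pos b) habs); lra. }
  pose (f := fun s => G (y1 s) (y2 s) - G (fst X) (snd X)).
  assert (happrox : forall s, - dl <= s <= dl ->
    Rabs (f s - s * (a ^ 2 + b ^ 2)) <= dl * (a ^ 2 + b ^ 2) / 2).
  { intros s hs; destruct (hsmall s hs) as [h1 h2].
    replace (f s - s * (a ^ 2 + b ^ 2)) with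
      (G (y1 s) (y2 s) - G (fst X) (snd X)
       - (a * (y1 s - fst X) + b * (y2 s - snd X)))
      by (unfold f, y1, y2; ring).
    eapply Rle_trans; [apply hd; lra |].
    replace (dl * (a ^ 2 + b ^ 2) / 2)
      with ((a ^ 2 + b ^ 2) / (2 * M) * (dl * M)) by (field; lra).
    apply Rmult_le_compat_l; [lra | apply Rmax_lub; assumption]. }
  assert (hprod : 0 < dl * (a ^ 2 + b ^ 2)) by (apply Rmult_lt_0_compat; lra).
  destruct (IVT_cor f (- dl) dl) as [s [hs hfs]].
  - intros s; unfold f.
    apply continuity_pt_minus.
    + apply derivable_continuous_pt; econstructor.
      apply derivable_pt_lim_comp_2d; [apply dG | |].
      * apply is_derive_Reals; unfold y1; auto_derive; [exact I | reflexivity].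
      * apply is_derive_Reals; unfold y2; auto_derive; [exact I | reflexivity].
    + apply continuity_pt_const; intros ? ?; reflexivity.
  - lra.
  - assert (h1 := happrox (- dl)); assert (h2 := happrox dl).
    apply Rabs_le_between in h1; [|lra]; apply Rabs_le_between in h2; [|lra].
    nra.
  - destruct (hsmall s hs) as [h1 h2].
    exists (y1 s, y2 s); split; [split |split]; simpl.
    + change (Rabs (y1 s - fst X) < eps); lra.
    + change (Rabs (y2 s - snd X) < eps); lra.
    + unfold f in hfs; lra.
    + intros E.
      (* [Y - X] has the nonzero component [dl] along [(-b, a)]. *)
      assert (E1 : y1 s = fst X) by (rewrite <- E; reflexivity).
      assert (E2 : y2 s = snd X) by (rewrite <- E; reflexivity).
      unfold y1, y2 in E1, E2.
      assert (dl * (a ^ 2 + b ^ 2) = 0); [|lra].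
      replace (dl * (a ^ 2 + b ^ 2)) with
        (a * (snd X + dl * a + s * b - snd X)
         - b * (fst X - dl * b + s * a - fst X)) by ring.
      rewrite E1, E2; ring.
Qed.

Lemma level_curve_tangent (S : point -> Prop) (G Ga Gb : R -> R -> R)
    (X Q : point) :
  (forall x y, differentiable_pt_lim G x y (Ga x y) (Gb x y)) ->
  (forall Y, S Y <-> G (fst Y) (snd Y) = G (fst X) (snd X)) ->
  0 < Ga (fst X) (snd X) ^ 2 + Gb (fst X) (snd X) ^ 2 ->
  Q <> X ->
  Ga (fst X) (snd X) * (fst Q - fst X)
    + Gb (fst X) (snd X) * (snd Q - snd X) = 0 ->
  is_tangent_line S X Q.
Proof.
  intros dG hS hgrad hQ horth; repeat split.
  - exact hQ.
  - apply hS; reflexivity.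
  - intros eps.
    destruct (level_curve_not_isolated G Ga Gb X dG hgrad eps)
      as [Y [hY [hG hYX]]].
    exists Y; rewrite hS; auto.
  - refine (filterlim_filter_le_1 _ _
      (level_curve_secants G Ga Gb X Q dG hgrad hQ horth)).
    intros T; unfold within; apply filter_imp; intros Y hT [hY hYX].
    apply hT; split; [apply hS, hY | exact hYX].
Qed.

(** * Gradients of the equations of the circle and of the lemniscate *)

Lemma sqdist_gradient (A : point) (x y : R) :
  differentiable_pt_lim (fun x y => sqdist A (x, y)) x y
    (2 * (x - fst A)) (2 * (y - snd A)).
Proof.
  intros eps.
  assert (he : 0 < eps / 2) by (pose proof (cond_pos eps); lra).
  exists (mkposreal _ he); simpl; intros u v hu hv; unfold sqdist; simpl.
  set (h := u - x) in *; set (k := v - y) in *.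
  replace (_ - _ - _) with (h ^ 2 + k ^ 2) by (unfold h, k; ring).
  rewrite <- (pow2_abs h), <- (pow2_abs k).
  rewrite Rabs_pos_eq by nra.
  pose proof (Rmax_l (Rabs h) (Rabs k)); pose proof (Rmax_r (Rabs h) (Rabs k)).
  pose proof (Rabs_pos h); pose proof (Rabs_pos k).
  set (m := Rmax (Rabs h) (Rabs k)) in *.
  nra.
Qed.

(** The product rule; the error term of the product map itself is
    [(u - c) (v - d)]. *)
Lemma sqdist_mul_gradient (A B : point) (x y : R) :
  differentiable_pt_lim (fun x y => sqdist A (x, y) * sqdist B (x, y)) x y
    (sqdist B (x, y) * (2 * (x - fst A)) + sqdist A (x, y) * (2 * (x - fst B)))
    (sqdist B (x, y) * (2 * (y - snd A)) + sqdist A (x, y) * (2 * (y - snd B))).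
Proof.
  apply (differentiable_pt_lim_comp Rmult).
  2, 3: apply sqdist_gradient.
  intros eps; exists eps; intros u v hu hv.
  set (c := sqdist A (x, y)) in *; set (d := sqdist B (x, y)) in *.
  replace (_ - _ - _) with ((u - c) * (v - d)) by ring.
  rewrite Rabs_mult.
  apply Rmult_le_compat; try apply Rabs_pos; [lra | apply Rmax_r].
Qed.

Lemma circle_sqdist (P : point) (r : R) (Y : point) :
  0 <= r -> (circle P r Y <-> sqdist P Y = r ^ 2).
Proof.
  intros hr; unfold circle; split; intros h.
  - rewrite <- pdist_sqr, h; reflexivity.
  - apply eq_of_sqr_eq; [apply pdist_ge0 | exact hr | rewrite pdist_sqr; exact h].
Qed.

Lemma lemniscate_sqdist (F1 F2 Y : point) :
  lemniscate F1 F2 Y <->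
  sqdist F1 Y * sqdist F2 Y = (sqdist F1 F2 / 4) ^ 2.
Proof.
  unfold lemniscate; rewrite <- !pdist_sqr, <- Rpow_mult_distr.
  split; intros h.
  - rewrite h; f_equal; lra.
  - apply eq_of_sqr_eq.
    + apply Rmult_le_pos; apply pdist_ge0.
    + pose proof (pow2_ge_0 (pdist F1 F2)); lra.
    + rewrite h; f_equal; lra.
Qed.

(** * Two non-parallel lines through a point *)

(** With [P] as common origin, the direction of the first line is the multiple
    [c] of that of the second. *)
Lemma line_incl (A B C D P Y : point) :
  C <> D -> line A B P -> line C D P ->
  (fst B - fst A) * (snd D - snd C) - (snd B - snd A) * (fst D - fst C) = 0 ->
  line A B Y -> line C D Y.
Proof.
  intros hCD hP1 hP2 h0 hY.
  apply sqdist_gt0 in hCD; unfold sqdist in hCD.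
  apply lineE in hP1; apply lineE in hP2; apply lineE in hY; apply lineE.
  destruct hP1 as [s [s1 s2]], hP2 as [t [t1 t2]], hY as [k [k1 k2]].
  set (u1 := fst B - fst A) in *; set (u2 := snd B - snd A) in *.
  set (v1 := fst D - fst C) in *; set (v2 := snd D - snd C) in *.
  set (c := (u1 * v1 + u2 * v2) / (v1 ^ 2 + v2 ^ 2)).
  assert (hu1 : u1 = c * v1).
  { unfold c; apply Rmult_eq_reg_r with (v1 ^ 2 + v2 ^ 2); [|lra].
    replace ((u1 * v1 + u2 * v2) / (v1 ^ 2 + v2 ^ 2) * v1 * (v1 ^ 2 + v2 ^ 2))
      with (u1 * (v1 ^ 2 + v2 ^ 2) - v2 * (u1 * v2 - u2 * v1)) by (field; lra).
    rewrite h0; ring. }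
  assert (hu2 : u2 = c * v2).
  { unfold c; apply Rmult_eq_reg_r with (v1 ^ 2 + v2 ^ 2); [|lra].
    replace ((u1 * v1 + u2 * v2) / (v1 ^ 2 + v2 ^ 2) * v2 * (v1 ^ 2 + v2 ^ 2))
      with (u2 * (v1 ^ 2 + v2 ^ 2) + v1 * (u1 * v2 - u2 * v1)) by (field; lra).
    rewrite h0; ring. }
  exists (t + (k - s) * c); split.
  - replace (fst Y) with (fst C + t * v1 + (k - s) * u1) by lra.
    rewrite hu1; ring.
  - replace (snd Y) with (snd C + t * v2 + (k - s) * u2) by lra.
    rewrite hu2; ring.
Qed.

Lemma not_parallel_cross (A B C D P : point) :
  A <> B -> C <> D -> line A B P -> line C D P ->
  ~ parallel (line A B) (line C D) ->
  (fst B - fst A) * (snd D - snd C) - (snd B - snd A) * (fst D - fst C) <> 0.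
Proof.
  intros hAB hCD hP1 hP2 hpar h0; apply hpar; left; intros Y; split.
  - apply (line_incl A B C D P Y hCD hP1 hP2 h0).
  - apply (line_incl C D A B P Y hAB hP2 hP1); lra.
Qed.

(** * The antiparallelogram *)

(** Here [N = |u|^2 = |v|^2] and [w = u.v], and the hypotheses are
    [|s u - t v|^2 = 2 N] (the side [F1 F2]) and
    [|(1 - s) u - (1 - t) v|^2 = 2 N] (the side [A B]).  Their difference is
    [2 (s + t - 1) (N - w) = 0]; the factor [N - w] vanishes only when [u = v],
    that is, for a parallelogram. *)
Lemma crossing_parameters (N w s t : R) :
  N <> w ->
  N * (s ^ 2 + t ^ 2) - 2 * s * t * w = 2 * N ->
  N * ((1 - s) ^ 2 + (1 - t) ^ 2) - 2 * (1 - s) * (1 - t) * w = 2 * N ->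
  s + t = 1 /\ 2 * s * t * (N + w) = - N.
Proof.
  intros hNw h1 h2.
  assert (hst : (s + t - 1) * (N - w) = 0) by lra.
  apply Rmult_integral in hst; destruct hst as [hst | hst]; [|lra].
  replace t with (1 - s) in * by lra.
  split; lra.
Qed.

(** The vectors from the foci to [X] are [((1 + s) u + s v) / 2] and
    [(t u + (1 + t) v) / 2].  The claims are multiplied by [t] and by [s] so that
    the scalar product [w] occurs only in [2 s t w], which the last hypothesis
    evaluates. *)
Lemma antiparallelogram_focal_radii (p q u1 u2 v1 v2 s t N w : R) :
  u1 ^ 2 + u2 ^ 2 = N -> v1 ^ 2 + v2 ^ 2 = N -> u1 * v1 + u2 * v2 = w ->
  s + t = 1 -> 2 * s * t * (N + w) = - N ->
  let X := (p + (t * u1 + s * v1) / 2, q + (t * u2 + s * v2) / 2) in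
  t * sqdist (p - s * u1, q - s * u2) X = - (s * N / 2) /\
  s * sqdist (p - t * v1, q - t * v2) X = - (t * N / 2).
Proof.
  intros hu hv hw hst hN X; unfold sqdist, X; simpl.
  split.
  - replace (t * _) with
      (t / 4 * ((t + 2 * s) ^ 2 * (u1 ^ 2 + u2 ^ 2) + s ^ 2 * (v1 ^ 2 + v2 ^ 2))
       + (t + 2 * s) / 4 * (2 * s * t * (u1 * v1 + u2 * v2))) by field.
    rewrite hu, hv, hw.
    replace (2 * s * t * w) with (- N - 2 * s * t * N) by lra.
    replace t with (1 - s) by lra; field.
  - replace (s * _) with
      (s / 4 * ((s + 2 * t) ^ 2 * (v1 ^ 2 + v2 ^ 2) + t ^ 2 * (u1 ^ 2 + u2 ^ 2))
       + (s + 2 * t) / 4 * (2 * s * t * (u1 * v1 + u2 * v2))) by field.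
    rewrite hu, hv, hw.
    replace (2 * s * t * w) with (- N - 2 * s * t * N) by lra.
    replace s with (1 - t) by lra; field.
Qed.

(** * Tangent lines of the circle and of the lemniscate *)

(** The point named here is [X] plus the quarter turn of [X - P]; it spans with
    [X] the common tangent line. *)
Lemma tangent_direction_neq (P X : point) :
  X <> P -> (fst X - (snd X - snd P), snd X + (fst X - fst P)) <> X.
Proof.
  intros hXP E; apply hXP, point_eq.
  - assert (h := f_equal snd E); simpl in h; lra.
  - assert (h := f_equal fst E); simpl in h; lra.
Qed.

Lemma circle_tangent (P X : point) (r : R) :
  0 <= r -> X <> P -> circle P r X ->
  is_tangent_line (circle P r) X
    (fst X - (snd X - snd P), snd X + (fst X - fst P)).
Proof.
  intros hr hXP hX.
  apply (level_curve_tangent _ _ _ _ _ _ (sqdist_gradient P)).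
  - intros Y; rewrite <- !surjective_pairing, (circle_sqdist P r Y hr).
    apply (circle_sqdist P r X hr) in hX; rewrite hX; reflexivity.
  - assert (h : P <> X) by congruence.
    apply sqdist_gt0 in h; unfold sqdist in h; lra.
  - apply tangent_direction_neq, hXP.
  - simpl; ring.
Qed.

(** The vector on the left of the two equations is half the gradient at [X] of
    the product of the squared focal distances. *)
Lemma lemniscate_tangent (F1 F2 P X : point) (k : R) :
  k <> 0 -> X <> P -> lemniscate F1 F2 X ->
  sqdist F2 X * (fst X - fst F1) + sqdist F1 X * (fst X - fst F2)
    = k * (fst X - fst P) ->
  sqdist F2 X * (snd X - snd F1) + sqdist F1 X * (snd X - snd F2)
    = k * (snd X - snd P) ->
  is_tangent_line (lemniscate F1 F2) X
    (fst X - (snd X - snd P), snd X + (fst X - fst P)).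
Proof.
  intros hk hXP hX h1 h2.
  assert (g1 : sqdist F2 X * (2 * (fst X - fst F1))
             + sqdist F1 X * (2 * (fst X - fst F2))
             = 2 * k * (fst X - fst P)) by lra.
  assert (g2 : sqdist F2 X * (2 * (snd X - snd F1))
             + sqdist F1 X * (2 * (snd X - snd F2))
             = 2 * k * (snd X - snd P)) by lra.
  apply (level_curve_tangent _ _ _ _ _ _ (sqdist_mul_gradient F1 F2)).
  - intros Y; rewrite <- !surjective_pairing, lemniscate_sqdist.
    apply lemniscate_sqdist in hX; rewrite hX; reflexivity.
  - rewrite <- !surjective_pairing, g1, g2.
    assert (h : P <> X) by congruence.
    apply sqdist_gt0 in h; unfold sqdist in h.
    assert (hk2 : 0 < k ^ 2) by (apply pow2_gt_0, hk).
    replace ((2 * k * (fst X - fst P)) ^ 2 + (2 * k * (snd X - snd P)) ^ 2)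
      with (4 * (k ^ 2 * ((fst X - fst P) ^ 2 + (snd X - snd P) ^ 2))) by ring.
    apply Rmult_lt_0_compat; [lra | apply Rmult_lt_0_compat; assumption].
  - apply tangent_direction_neq, hXP.
  - rewrite <- !surjective_pairing, g1, g2; simpl; ring.
Qed.

(** * The theorem *)

Theorem mainTheorem4 (F1 F2 O A B P X : point)
  (hF : F1 <> F2)
  (hO : O = midpoint F1 F2)
  (hsides : strictly_opposite_sides (line F1 F2) A B)
  (hF1A : pdist F1 A = / sqrt 2 * pdist F1 F2)
  (hF2B : pdist F2 B = / sqrt 2 * pdist F1 F2)
  (hAB : pdist A B = pdist F1 F2)
  (hpar : ~ parallel (line F1 A) (line F2 B))
  (hP : line F1 A P /\ line F2 B P)
  (hX : X = midpoint A B) :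
  exists r : R,
    0 < r /\ circle P r X /\ circle P r O /\
    circle_touches_lemniscate P r F1 F2 X.
Proof.
  destruct hP as [hP1 hP2].
  assert (hF12 := sqdist_gt0 _ _ hF).
  assert (half : (/ sqrt 2) ^ 2 = / 2).
  { rewrite pow_inv, pow2_sqrt; lra. }
  assert (dA : sqdist F1 F2 = 2 * sqdist F1 A).
  { rewrite <- !pdist_sqr, hF1A, Rpow_mult_distr, half; lra. }
  assert (dB : sqdist F2 B = sqdist F1 A).
  { rewrite <- !pdist_sqr, hF1A, hF2B; reflexivity. }
  assert (dAB : sqdist A B = 2 * sqdist F1 A).
  { rewrite <- dA, <- !pdist_sqr, hAB; reflexivity. }
  assert (hAF : F1 <> A) by (intros <-; unfold sqdist in *; lra).
  assert (hBF : F2 <> B) by (intros <-; unfold sqdist in *; lra).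
  assert (hcr := not_parallel_cross _ _ _ _ _ hAF hBF hP1 hP2 hpar).
  apply lineE in hP1; apply lineE in hP2.
  destruct hP1 as [s [s1 s2]], hP2 as [t [t1 t2]].
  destruct F1 as [a1 a2], F2 as [b1 b2], A as [c1 c2], B as [d1 d2],
    P as [p q]; simpl in s1, s2, t1, t2, hcr.
  remember (c1 - a1) as u1 eqn:eu1; remember (c2 - a2) as u2 eqn:eu2.
  remember (d1 - b1) as v1 eqn:ev1; remember (d2 - b2) as v2 eqn:ev2.
  assert (ec1 : c1 = p + (1 - s) * u1) by lra.
  assert (ec2 : c2 = q + (1 - s) * u2) by lra.
  assert (ed1 : d1 = p + (1 - t) * v1) by lra.
  assert (ed2 : d2 = q + (1 - t) * v2) by lra.
  assert (ea1 : a1 = p - s * u1) by lra.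
  assert (ea2 : a2 = q - s * u2) by lra.
  assert (eb1 : b1 = p - t * v1) by lra.
  assert (eb2 : b2 = q - t * v2) by lra.
  clear s1 s2 t1 t2 eu1 eu2 ev1 ev2.
  subst a1 a2 b1 b2 c1 c2 d1 d2.
  remember (u1 ^ 2 + u2 ^ 2) as N eqn:eN; symmetry in eN.
  remember (u1 * v1 + u2 * v2) as w eqn:ew; symmetry in ew.
  assert (eFA : sqdist (p - s * u1, q - s * u2)
                  (p + (1 - s) * u1, q + (1 - s) * u2) = N).
  { rewrite <- eN; unfold sqdist; simpl; ring. }
  rewrite eFA in dA, dB, dAB.
  assert (eN2 : v1 ^ 2 + v2 ^ 2 = N).
  { rewrite <- dB; unfold sqdist; simpl; ring. }
  assert (hN : 0 < N) by lra.
  (* Lagrange's identity [|u|^2 |v|^2 = (u.v)^2 + (u x v)^2]. *)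
  assert (hNw : N <> w).
  { intros E; apply hcr.
    assert (h : (u1 * v2 - u2 * v1) ^ 2 = 0).
    { replace ((u1 * v2 - u2 * v1) ^ 2) with
        ((u1 ^ 2 + u2 ^ 2) * (v1 ^ 2 + v2 ^ 2) - (u1 * v1 + u2 * v2) ^ 2)
        by ring.
      rewrite eN, eN2, ew, E; ring. }
    apply Rsqr_0_uniq; rewrite Rsqr_pow2; exact h. }
  destruct (crossing_parameters N w s t hNw) as [hst hstN].
  { rewrite <- dA; unfold sqdist; simpl.
    transitivity (s ^ 2 * (u1 ^ 2 + u2 ^ 2) + t ^ 2 * (v1 ^ 2 + v2 ^ 2)
                  - 2 * s * t * (u1 * v1 + u2 * v2)); [|ring].
    rewrite eN, eN2, ew; ring. }
  { rewrite <- dAB; unfold sqdist; simpl.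
    transitivity ((1 - s) ^ 2 * (u1 ^ 2 + u2 ^ 2)
                  + (1 - t) ^ 2 * (v1 ^ 2 + v2 ^ 2)
                  - 2 * (1 - s) * (1 - t) * (u1 * v1 + u2 * v2)); [|ring].
    rewrite eN, eN2, ew; ring. }
  (* Otherwise [N] would be zero. *)
  assert (hst0 : s * t <> 0) by (intros E; nra).
  assert (hs0 : s <> 0) by (intros E; apply hst0; rewrite E; ring).
  assert (ht0 : t <> 0) by (intros E; apply hst0; rewrite E; ring).
  assert (eX : X = (p + (t * u1 + s * v1) / 2, q + (t * u2 + s * v2) / 2)).
  { rewrite hX; apply point_eq; rewrite ?midpoint_fst, ?midpoint_snd; simpl;
      replace t with (1 - s) by lra; field. }
  destruct (antiparallelogram_focal_radii p q u1 u2 v1 v2 s t N w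
              eN eN2 ew hst hstN) as [rad1 rad2].
  rewrite <- eX in rad1, rad2.
  set (F1 := (p - s * u1, q - s * u2)) in *.
  set (F2 := (p - t * v1, q - t * v2)) in *.
  set (P := (p, q)) in *.
  assert (hXP : X <> P).
  { intros E; rewrite eX in E; apply hcr.
    assert (h1 := f_equal fst E); assert (h2 := f_equal snd E); simpl in h1, h2.
    apply Rmult_eq_reg_l with t; [|exact ht0].
    replace (t * (u1 * v2 - u2 * v1)) with
      ((t * u1 + s * v1) * v2 - (t * u2 + s * v2) * v1) by ring.
    replace (t * u1 + s * v1) with 0 by lra.
    replace (t * u2 + s * v2) with 0 by lra; ring. }
  (* [X - O] is [(u + v) / 2]. *)
  assert (hXO : X <> midpoint F1 F2).
  { intros E; rewrite eX in E; apply hcr.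
    assert (h1 := f_equal fst E); assert (h2 := f_equal snd E).
    rewrite midpoint_fst in h1; rewrite midpoint_snd in h2.
    unfold F1, F2 in h1, h2; simpl in h1, h2.
    assert (hv1 : v1 = - u1).
    { replace t with (1 - s) in h1 by lra; lra. }
    assert (hv2 : v2 = - u2).
    { replace t with (1 - s) in h2 by lra; lra. }
    rewrite hv1, hv2; ring. }
  (* [O - P] is [- (s u + t v) / 2], and [|u| = |v|]. *)
  assert (hPO : sqdist P X = sqdist P O).
  { rewrite hO, eX; unfold sqdist; rewrite midpoint_fst, midpoint_snd.
    unfold P, F1, F2; simpl.
    transitivity ((t ^ 2 * N + s ^ 2 * N + 2 * s * t * w) / 4).
    - transitivity ((t ^ 2 * (u1 ^ 2 + u2 ^ 2) + s ^ 2 * (v1 ^ 2 + v2 ^ 2)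
                     + 2 * s * t * (u1 * v1 + u2 * v2)) / 4); [field |].
      rewrite eN, eN2, ew; reflexivity.
    - transitivity ((s ^ 2 * (u1 ^ 2 + u2 ^ 2) + t ^ 2 * (v1 ^ 2 + v2 ^ 2)
                     + 2 * s * t * (u1 * v1 + u2 * v2)) / 4); [|field].
      rewrite eN, eN2, ew; field. }
  assert (rad1' : sqdist F1 X = - (s * N / 2) / t).
  { apply Rmult_eq_reg_l with t; [rewrite rad1; field |]; assumption. }
  assert (rad2' : sqdist F2 X = - (t * N / 2) / s).
  { apply Rmult_eq_reg_l with s; [rewrite rad2; field |]; assumption. }
  assert (hlem : lemniscate F1 F2 X).
  { apply lemniscate_sqdist; rewrite dA, rad1', rad2'; field; split; assumption. }
  exists (pdist P X).
  assert (hr : 0 < pdist P X).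
  { rewrite pdist_sqrt; apply sqrt_lt_R0, sqdist_gt0; congruence. }
  assert (hcO : circle P (pdist P X) O).
  { unfold circle; rewrite !pdist_sqrt, hPO; reflexivity. }
  assert (hcX : circle P (pdist P X) X) by reflexivity.
  do 3 (split; [assumption |]).
  do 3 (split; [assumption |]).
  exists (fst X - (snd X - snd P), snd X + (fst X - fst P)); split.
  - apply circle_tangent; [lra | assumption | assumption].
  (* [t^2 (X - F1) + s^2 (X - F2) = X - P] because [s + t = 1]. *)
  - apply lemniscate_tangent with (k := - (N / (2 * (s * t))));
      [ | assumption | assumption | | ].
    + assert (h : N / (2 * (s * t)) <> 0); [|lra].
      unfold Rdiv; apply Rmult_integral_contrapositive_currified; [lra |].
      apply Rinv_neq_0_compat; lra.
    + rewrite rad1', rad2', eX; unfold F1, F2, P; simpl.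
      replace t with (1 - s) in * by lra; field; split; assumption.
    + rewrite rad1', rad2', eX; unfold F1, F2, P; simpl.
      replace t with (1 - s) in * by lra; field; split; assumption.
Qed.
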